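(* Let $\Phi(v_1,\dots,v_n)=\frac{\kappa}{n}\sum_{i=1}^n v_i^n+h(v_1v_2\cdots v_n)$. Let $r\in C^2((0,1])\cap C([0,1])$ be a solution of the radial equilibrium equation $$\frac{d}{dR}\left[R^{n-1}\Phi_{,1}(r(R))\right]=(n-1)R^{n-2}\Phi_{,2}(r(R)),\qquad 0<R<1,$$ satisfying $r(0)>0$. Then the radial component of Cauchy stress $$T(r(R))=\left[\frac{R}{r(R)}\right]^{n-1}\Phi_{,1}(r(R))$$ is such that the limit $$\lim_{R\to0^+}\bigl(T(r(R))-(n-1)\kappa\ln R\bigr)$$ exists and is finite, and, regarding $T$ along the solution as a function $T(v)$ of the circumferential strain $v=r(R)/R$, the limit $$\lim_{v\to\infty}\bigl(T(v)+\kappa(n-1)\ln v\bigr)$$ exists and is finite. In particular, $\lim_{R\to0^+}T(r(R))=\lim_{v\to\infty}T(v)=-\infty$.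
   Context: $n\in\{2,3\}$ and $\kappa>0$. The function $h:(0,\infty)\to[0,\infty)$ is $C^1$ (with second derivative existing) and satisfies: $h''(d)>0$ for all $d>0$; $\lim_{d\to0^+}h(d)=\infty$; $\lim_{d\to\infty}h(d)/d=\infty$; $\lim_{d\to0^+}h'(d)=-\infty$; $\lim_{d\to\infty}h'(d)=\infty$. $\Phi_{,i}$ denotes the partial derivative of $\Phi$ with respect to its $i$-th argument, and $\Phi_{,i}(r(R))$ abbreviates $\Phi_{,i}\left(r'(R),\frac{r(R)}{R},\dots,\frac{r(R)}{R}\right)$. All radial maps $r$ considered as solutions satisfy $r'(R)>0$ and $r(R)/R>0$ for $R\in(0,1]$ (so that $\Phi$ is evaluated at positive arguments). *)

(* Defs.v *)
From mathcomp Require Import all_boot all_order all_algebra.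
From mathcomp Require Import all_classical all_reals all_analysis.
Set Implicit Arguments.
Unset Strict Implicit.
Unset Printing Implicit Defensive.
Import Order.TTheory GRing.Theory Num.Theory.
Import numFieldNormedType.Exports.

Local Open Scope ring_scope.
Local Open Scope classical_set_scope.

(* Derivatives relative to a set [A] of reals: at an interior point of [A] they
   are the usual ones, at an end point of an interval [A] the one-sided ones. *)
Definition derivable_in (R : realType) (A : set R) (f : R -> R) (x : R) : Prop :=
  cvg ((f y - f x) / (y - x) @[y --> within A x^']).

Definition derive_in (R : realType) (A : set R) (f : R -> R) (x : R) : R :=
  lim ((f y - f x) / (y - x) @[y --> within A x^']).

Definition C2_on (R : realType) (A : set R) (f : R -> R) : Prop :=
  [/\ forall x, A x -> derivable_in A f x,
      forall x, A x -> derivable_in A (derive_in A f) x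
    & {within A, continuous (derive_in A (derive_in A f))}].

(* Arguments are numbered from 0, so the partial derivatives with
   respect to the 1st and 2nd arguments are [partial Phi 0] and [partial Phi 1].
   The index is a [nat] so that no proof of [i < n] is needed (for [n <= i] the
   direction is the zero vector). *)
Definition partial (R : realType) (n : nat) (Phi : 'rV[R]_n -> R) (i : nat)
    (v : 'rV[R]_n) : R :=
  'D_(\row_(j < n) ((j : nat) == i)%:R) Phi v.

Definition stored_energy (R : realType) (n : nat) (kappa : R) (h : R -> R)
    (v : 'rV[R]_n) : R :=
  kappa / n%:R * \sum_(i < n) v 0 i ^+ n + h (\prod_(i < n) v 0 i).

(* [h] stands for a function on the open half-line; it is unconstrained on the
   nonpositive reals. *)
Definition admissible_h (R : realType) (h : R -> R) : Prop :=
  [/\ (forall d : R, 0 < d -> 0 <= h d),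
      (forall d : R, 0 < d -> derivable h d 1) /\ {in `]0, +oo[, continuous h^`()},
      (forall d : R, 0 < d -> derivable h^`() d 1 /\ 0 < h^`(2) d),
      h d @[d --> 0^'+] --> +oo /\ h d / d @[d --> +oo] --> +oo
    & h^`() d @[d --> 0^'+] --> -oo /\ h^`() d @[d --> +oo] --> +oo].

Definition rderiv (R : realType) (r : R -> R) (x : R) : R :=
  derive_in `]0, 1] r x.

Definition hoop (R : realType) (r : R -> R) (x : R) : R := r x / x.

(* (r'(x), r(x)/x, ..., r(x)/x) *)
Definition principal_stretches (R : realType) (n : nat) (r : R -> R) (x : R) :
    'rV[R]_n :=
  \row_(i < n) (if (i : nat) == 0%N then rderiv r x else hoop r x).

Definition radial_equilibrium (R : realType) (n : nat) (Phi : 'rV[R]_n -> R)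
    (r : R -> R) : Prop :=
  forall x : R, 0 < x < 1 ->
    is_derive x (1 : R)
      (fun s => s ^+ n.-1 * partial Phi 0 (principal_stretches n r s))
      (n.-1%:R * x ^+ n.-2 * partial Phi 1 (principal_stretches n r x)).

Definition radial_solution (R : realType) (n : nat) (Phi : 'rV[R]_n -> R)
    (r : R -> R) : Prop :=
  [/\ C2_on `]0, 1] r,
      {within `[0, 1], continuous r},
      (forall x : R, 0 < x <= 1 -> 0 < rderiv r x /\ 0 < hoop r x)
    & radial_equilibrium Phi r].

Definition radial_stress (R : realType) (n : nat) (Phi : 'rV[R]_n -> R)
    (r : R -> R) (x : R) : R :=
  (x / r x) ^+ n.-1 * partial Phi 0 (principal_stretches n r x).

(* [Tv] is [T] regarded as a function of the circumferential strain.  The second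
   clause says that the strain takes every sufficiently large value, so that
   [Tv v] is determined by [T] for large [v] and its limit at +oo is not a
   statement about arbitrary values. *)
Definition function_of_strain (R : realType) (r T Tv : R -> R) : Prop :=
  (forall x : R, 0 < x <= 1 -> Tv (hoop r x) = T x) /\
  (\forall v \near +oo, exists2 x : R, 0 < x <= 1 & hoop r x = v).

(* Main.v *)
(* Along a solution put [q = r/R] and [w = r'/q].  Then
   [T = kappa w^(n-1) + h'(w q^n)], and the equilibrium equation becomes
   [T' = (n-1) kappa (1 - w^n) / R], in which [h] no longer appears, while
   [q' = (w - 1) q / R].  Since [h'] is increasing, these monotonicities and
   [r 0 > 0] force [w <= 1].  Hence [T - (n-1) kappa ln R] is nonincreasing and,
   as [w^n / R <= w / R = (ln r)'], it becomes nondecreasing after adding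
   [(n-1) kappa ln r], which is bounded near 0; so it has a finite limit.
   Also [q] is nonincreasing, and [T] is constant wherever [q] is, so [T] is a
   function of [q], and [T + (n-1) kappa ln q = T - (n-1) kappa ln R +
   (n-1) kappa ln r]. *)
Require Import Defs.
From mathcomp Require Import all_boot all_order all_algebra.
From mathcomp Require Import all_classical all_reals all_analysis.
From mathcomp Require Import ring lra.
Import Order.TTheory GRing.Theory Num.Theory.
Import numFieldNormedType.Exports.
Local Open Scope ring_scope.
Local Open Scope classical_set_scope.
Set Implicit Arguments.
Unset Strict Implicit.
Unset Printing Implicit Defensive.

(** * Derivatives relative to a set and along a line *)

Section Restriction.
Variable R : realType.
Implicit Types (f : R -> R) (x : R) (A : set R).

(** The filter [F] is left free: below it is the full punctured neighbourhood at interior points,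
    and a one-sided one where only one side is under control. *)
Lemma derive_in_cvg A f x (F : set_system R) {FF : Filter F} :
  F `=>` within A x^' -> derivable_in A f x ->
  (f y - f x) / (y - x) @[y --> F] --> derive_in A f x.
Proof.
move=> FA dfx; apply: cvg_trans dfx => U.
exact: FA.
Qed.

(** Passes from difference quotients in the increment at 0, as in [derive], to those in the moving
    point at [x], as in [derive_in]. *)
Lemma shift_dnbhs x : shift x h @[h --> (0 : R)^'] `=>` x^'.
Proof.
move=> U; rewrite /dnbhs /within /= !near_simpl (near_shift 0).
apply: filterS => y /=; rewrite subr0 => yU y0; apply: yU.
by apply: contra_neq y0 => yx0; lra.
Qed.

Lemma is_derive_in A f x : A° x -> derivable_in A f x ->
  is_derive x 1 f (derive_in A f x).
Proof.
move=> Ax dfx.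
have xA : x^' `=>` within A x^'.
  move=> U; rewrite /within /= => UA.
  have : \forall y \near x^', A y by exact: nbhs_dnbhs.
  by move: UA; apply: filterS2 => y; apply.
have lim0 : h^-1 *: ((f \o shift x) (h *: 1) - f x) @[h --> (0 : R)^'] -->
    derive_in A f x.
  have -> : (fun h : R => h^-1 *: ((f \o shift x) (h *: 1) - f x)) =
      (fun y => (f y - f x) / (y - x)) \o shift x.
    by apply/funext => h /=; rewrite addrK mulrC [h *: 1]mulr1.
  exact: (@cvg_comp _ _ _ (shift x) _ _ _ _ (@shift_dnbhs x)
    (derive_in_cvg xA dfx)).
by apply: DeriveDef; [exact: (cvgP _ lim0) | exact/cvg_lim].
Qed.

(** Reduces [partial] to calculus in one variable. *)
Lemma is_derive_line n (f : 'rV[R]_n -> R) (v w : 'rV[R]_n) (l : R) :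
  is_derive (0 : R) 1 (fun t => f (t *: w + v)) l -> 'D_w f v = l.
Proof.
move=> [_ <-]; rewrite /derive.
suff -> : (fun t : R => t^-1 *: ((f \o shift v) (t *: w) - f v)) =
    (fun t => t^-1 *: (((fun t => f (t *: w + v)) \o shift 0) (t *: 1) -
      f (0 *: w + v))) by [].
by apply/funext => t /=; rewrite addr0 scale0r add0r [t *: 1]mulr1.
Qed.

End Restriction.

(** * Partial derivatives of the stored energy *)

Section StoredEnergy.
Variables (R : realType) (n : nat) (kappa : R) (h : R -> R).

(** Along the i-th direction the sum of powers is [(t + v 0 i) ^+ n] plus a constant [S], and the
    product is [t + v 0 i] times a constant [P]. The factor n from the power rule cancels the
    division by n in the energy. *)
Lemma partial_stored_energy (i : 'I_n) (v : 'rV[R]_n) :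
  v 0 i != 0 -> derivable h (\prod_j v 0 j) 1 ->
  partial (stored_energy kappa h) i v =
  kappa * v 0 i ^+ n.-1 + derive1 h (\prod_j v 0 j) * ((\prod_j v 0 j) / v 0 i).
Proof.
move=> vi0 dh; apply: is_derive_line.
have n0 : (n%:R : R) != 0 by rewrite pnatr_eq0 -lt0n; case: (i) => k; case: n.
pose S := \sum_(j | j != i) v 0 j ^+ n; pose P := \prod_(j | j != i) v 0 j.
have PE : (\prod_j v 0 j) / v 0 i = P by rewrite (bigD1 i) //= mulrAC mulfV ?mul1r.
have -> : (fun t : R => stored_energy kappa h
      (t *: (\row_(j < n) ((j : nat) == i)%:R) + v)) =
    (fun t => kappa / n%:R * ((t + v 0 i) ^+ n + S) + h ((t + v 0 i) * P)).
  apply/funext => t; rewrite /stored_energy (bigD1 i) //= [X in h X](bigD1 i) //=.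
  rewrite !mxE eqxx mulr1.
  congr (_ * (_ + _) + h (_ * _)); apply: eq_bigr => j ji; rewrite !mxE;
    by rewrite (negbTE (ji : (j : nat) != i)) mulr0 add0r.
have did : is_derive (0 : R) 1 (fun t => t + v 0 i) 1 by exact: is_derive_shift.
have dP : is_derive (0 : R) 1 (fun t => (t + v 0 i) * P) P.
  have := is_deriveM did (is_derive_cst P (0 : R) 1).
  by rewrite scaler0 add0r [P *: _]mulr1; apply.
have dX : is_derive (0 : R) 1 (fun t => (t + v 0 i) ^+ n) (n%:R * v 0 i ^+ n.-1).
  have := is_deriveX n did; rewrite add0r [_ *: _]mulr1.
  by congr (is_derive _ _ _ _); apply/funext => t; rewrite fctE.
have dh0 : is_derive ((0 + v 0 i) * P) 1 h (derive1 h (\prod_j v 0 j)).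
  by rewrite add0r -PE mulrCA mulfV // mulr1 derive1E; exact/derivableP.
have := is_deriveD (is_deriveZ (kappa / n%:R)
  (is_deriveD dX (is_derive_cst S (0 : R) 1))) 
  (@is_derive1_comp _ h (fun t => (t + v 0 i) * P) 0 _ _ dh0 dP).
rewrite PE addr0 => /is_derive_eq; apply.
by congr (_ + _); rewrite [_ *: _]mulrA mulfVK.
Qed.

End StoredEnergy.

Lemma prod_principal_stretches (R : realType) (m : nat) (r : R -> R) (x : R) :
  \prod_j principal_stretches m.+1 r x 0 j = rderiv r x * hoop r x ^+ m.
Proof.
rewrite big_ord_recl !mxE /=; congr (_ * _).
under eq_bigr do rewrite mxE /=.
by rewrite prodr_const card_ord.
Qed.

(** * Monotonicity from the sign of the derivative *)

(** Derivatives are asked for in the open interval only, so that 0 and 1, where [r] is merely known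
    to be continuous or one-sidedly differentiable, may be end points. *)
Lemma derive_ge0_le (R : realType) (f df : R -> R) (a b : R) : a <= b ->
  (forall x : R, a < x < b -> is_derive x 1 f (df x) /\ 0 <= df x) ->
  {within `[a, b], continuous f} -> f a <= f b.
Proof.
rewrite le_eqVlt => /predU1P[<- //|ab] fdf fc.
have [|c] := @MVT _ f df a b ab _ fc; first by move=> x; rewrite in_itv /= => /fdf[].
rewrite in_itv /= => /fdf[_ df0] fba.
by rewrite -subr_ge0 fba mulr_ge0 // subr_ge0 ltW.
Qed.

Lemma derive_le0_ge (R : realType) (f df : R -> R) (a b : R) : a <= b ->
  (forall x : R, a < x < b -> is_derive x 1 f (df x) /\ df x <= 0) ->
  {within `[a, b], continuous f} -> f b <= f a.
Proof.
rewrite le_eqVlt => /predU1P[<- //|ab] fdf fc.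
have [|c] := @MVT _ f df a b ab _ fc; first by move=> x; rewrite in_itv /= => /fdf[].
rewrite in_itv /= => /fdf[_ df0] fba.
by rewrite -subr_le0 fba mulr_le0_ge0 // subr_ge0 ltW.
Qed.

Lemma is_derive_continuous (R : realType) (f : R -> R) (x l : R) :
  is_derive x 1 f l -> {for x, continuous f}.
Proof. by move=> [df _]; exact/differentiable_continuous/derivable1_diffP. Qed.

Lemma is_derive_within_continuous (R : realType) (f df : R -> R) (a b : R) :
  (forall x : R, a <= x <= b -> is_derive x 1 f (df x)) ->
  {within `[a, b], continuous f}.
Proof.
move=> fdf; apply: derivable_within_continuous => x.
by rewrite in_itv /= => /fdf[].
Qed.

Lemma itvI01 (R : realType) (a b x : R) :
  0 < a -> b < 1 -> a <= x <= b -> 0 < x < 1.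
Proof. by move=> a0 b1 /andP[ax xb]; rewrite (lt_le_trans a0 ax) (le_lt_trans xb). Qed.

(** * The bound [w <= 1] and the behaviour of the stress at the origin *)

(* [w] is the ratio of the radial to the circumferential strain, [g] is [h'] and
   [k] is [n - 1]. *)
Section StrainRatio.
Variables (R : realType) (k : nat) (kappa : R) (r p T g : R -> R).
Let q := hoop r.
Let w x := p x / q x.
Hypothesis kappa_gt0 : 0 < kappa.
Hypothesis r_inf_gt0 : exists2 r0 : R, 0 < r0 & forall x : R, 0 < x < 1 -> r0 <= r x.
Hypothesis r_derive : forall x : R, 0 < x < 1 -> is_derive x 1 r (p x).
Hypothesis p_gt0 : forall x : R, 0 < x < 1 -> 0 < p x.
Hypothesis p_continuous : forall x : R, 0 < x < 1 -> {for x, continuous p}.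
Hypothesis g_increasing : forall x y : R, 0 < x -> x < y -> g x < g y.
Hypothesis T_strains :
  forall x : R, 0 < x < 1 -> T x = kappa * w x ^+ k + g (w x * q x ^+ k.+1).
Hypothesis T_derive : forall x : R, 0 < x < 1 ->
  is_derive x 1 T (k%:R * kappa * x^-1 * (1 - w x ^+ k.+1)).

Lemma radius_gt0 (x : R) : 0 < x < 1 -> 0 < r x.
Proof. by case: r_inf_gt0 => r0 r00 rr0 /rr0; apply: lt_le_trans. Qed.

Lemma hoop_gt0 (x : R) : 0 < x < 1 -> 0 < q x.
Proof. by move=> x01; rewrite divr_gt0 ?radius_gt0 //; case/andP: x01. Qed.

Lemma ratio_gt0 (x : R) : 0 < x < 1 -> 0 < w x.
Proof. by move=> x01; rewrite divr_gt0 ?hoop_gt0 ?p_gt0. Qed.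

Lemma hoop_derive (x : R) : 0 < x < 1 -> is_derive x 1 q ((w x - 1) * (q x / x)).
Proof.
move=> x01; have x0 : x != 0 by rewrite gt_eqF //; case/andP: x01.
have := is_deriveM (r_derive x01) (is_deriveV x0 (is_derive_id x 1)).
move/is_derive_eq; apply.
have rx := lt0r_neq0 (radius_gt0 x01).
rewrite /w /q /hoop /GRing.scale /=; field.
by rewrite x0 rx.
Qed.

Lemma ratio_continuous (x : R) : 0 < x < 1 -> {for x, continuous w}.
Proof.
move=> x01; apply: (@continuousM _ _ p (fun y => (q y)^-1)).
  exact: p_continuous.
apply: continuousV; first by rewrite lt0r_neq0 ?hoop_gt0.
exact: is_derive_continuous (hoop_derive x01).
Qed.

Lemma hoop_nondecreasing (a b : R) : 0 < a -> b < 1 -> a <= b ->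
  (forall x : R, a < x < b -> 1 <= w x) -> q a <= q b.
Proof.
move=> a0 b1 ab w1.
apply: (@derive_ge0_le _ _ (fun x => (w x - 1) * (q x / x))) => // [x xab|].
  have x01 : 0 < x < 1 by lra.
  split; first exact: hoop_derive.
  have x0 : 0 < x by lra.
  by rewrite mulr_ge0 ?subr_ge0 ?w1 // ltW // divr_gt0 ?hoop_gt0.
by apply: is_derive_within_continuous => x /(itvI01 a0 b1); exact: hoop_derive.
Qed.

Lemma stress_nonincreasing (a b : R) : 0 < a -> b < 1 -> a <= b ->
  (forall x : R, a < x < b -> 1 <= w x) -> T b <= T a.
Proof.
move=> a0 b1 ab w1.
apply: (@derive_le0_ge _ _ (fun x => k%:R * kappa * x^-1 * (1 - w x ^+ k.+1)))
  => // [x xab|].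
  have x01 : 0 < x < 1 by lra.
  split; first exact: T_derive.
  rewrite mulr_ge0_le0 ?subr_le0 ?exprn_ege1 ?w1 //.
  have x0 : 0 < x by lra.
  by rewrite !mulr_ge0 ?invr_ge0 // ltW.
by apply: is_derive_within_continuous => x /(itvI01 a0 b1); exact: T_derive.
Qed.

(* Behind the last point [a] with [w a <= 1] the strain [q] increases and [T]
   decreases, whereas [T], as a function of [w] and [q], increases in both. *)
Lemma ratio_le1_propagates (a0 b : R) :
  0 < a0 -> a0 <= b -> b < 1 -> w a0 <= 1 -> w b <= 1.
Proof.
move=> a00 a0b b1 wa0; rewrite leNgt; apply/negP => wb.
pose A := [set x | a0 <= x <= b /\ w x <= 1].
have A0 : A a0 by rewrite /A /= lexx.
have Aub : ubound A b by move=> x [/andP[]].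
have supA : has_sup A by split; [exists a0 | exists b].
pose a := sup A.
have a0a : a0 <= a by apply: ub_le_sup; [exists b | ].
have ab : a <= b by apply: ge_sup => //; exists a0.
have wgt x : a < x < b -> 1 <= w x.
  move=> /andP[ax xb]; rewrite leNgt; apply/negP => /ltW wx.
  have : x <= a by apply: ub_le_sup; [exists b | split=> //; lra].
  lra.
have a01 : 0 < a < 1 by lra.
(* The supremum belongs to [A]: were [w a > 1], continuity would give [w > 1] near [a], where [A]
   has points. *)
have wa : w a <= 1.
  rewrite leNgt; apply/negP => wa.
  have /cvgr_gt/(_ 1 wa) := ratio_continuous a01.
  move=> /nbhs_ballP[e /= e0 wball].
  have [x Ax xe] := sup_adherent e0 supA.
  have xa : x <= a by apply: ub_le_sup => //; exists b.
  have : 1 < w x.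
    by apply: wball; rewrite /ball /= ger0_norm ?subr_ge0 // ltrBlDr addrC -ltrBlDr.
  by case: Ax => _ wx; lra.
have q0 : 0 < q a := hoop_gt0 a01.
have w0 : 0 < w a := ratio_gt0 a01.
have qab : q a <= q b by apply: hoop_nondecreasing => //; lra.
have Tab : T b <= T a by apply: stress_nonincreasing => //; lra.
have b01 : 0 < b < 1 by lra.
move: Tab; apply/negP; rewrite -ltNge !T_strains // ler_ltD //.
  rewrite ler_pM2l //; apply: (@le_trans _ _ 1).
    by rewrite exprn_ile1 // ltW.
  by rewrite exprn_ege1 // ltW.
(* With n = [k.+1], the chain is w(a) q(a)^n <= q(a)^n < w(b) q(a)^n <= w(b) q(b)^n. *)
apply: g_increasing; first by rewrite mulr_gt0 ?exprn_gt0.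
apply: (@le_lt_trans _ _ (1 * q a ^+ k.+1)).
  by rewrite ler_pM2r ?exprn_gt0.
apply: (@lt_le_trans _ _ (w b * q a ^+ k.+1)).
  by rewrite ltr_pM2r ?exprn_gt0.
by rewrite ler_pM2l ?ratio_gt0 // lerXn2r // nnegrE ltW // (lt_le_trans q0).
Qed.

(* If [w > 1] all the way down to the origin then [q] is bounded there, so that
   [r x] tends to 0. *)
Lemma ratio_le1 (b : R) : 0 < b < 1 -> w b <= 1.
Proof.
move=> b01; have /andP[b0 b1] := b01.
have [[a [a0 ab wa]]|nex] := pselect (exists a, [/\ 0 < a, a <= b & w a <= 1]).
  exact: ratio_le1_propagates wa.
have w1 a : 0 < a -> a <= b -> 1 <= w a.
  move=> a0 ab; rewrite leNgt; apply/negP => /ltW wa; apply: nex.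
  by exists a.
case: r_inf_gt0 => r0 r00 rr0; have qb := hoop_gt0 b01.
(* At this point [x * q b <= r0 / 2], which contradicts r0 <= r(x) = x q(x) <= x q(b). *)
pose x := Num.min b (r0 / (2 * q b)).
have xb : x <= b by rewrite ge_min lexx.
have x0 : 0 < x by rewrite lt_min b0 divr_gt0 // mulr_gt0.
have : q x <= q b.
  by apply: hoop_nondecreasing => // y /andP[xy yb]; apply: w1; lra.
have : r0 <= r x by apply: rr0; rewrite x0 (le_lt_trans xb).
have : x * q b <= r0 / 2.
  apply: (@le_trans _ _ (r0 / (2 * q b) * q b)).
    by rewrite ler_pM2r // ge_min lexx orbT.
  by rewrite le_eqVlt; apply/orP; left; apply/eqP; field; rewrite lt0r_neq0.
rewrite [q x]/(r x / x) ler_pdivrMr // mulrC => h1 h2 h3.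
by have := le_trans h2 (le_trans h3 h1); lra.
Qed.

Let S x := T x - k%:R * kappa * ln x.

(** The logarithm removes the term k kappa / x from the derivative of [T], and what remains has a
    constant sign. *)
Lemma reduced_stress_derive (x : R) : 0 < x < 1 ->
  is_derive x 1 S (- (k%:R * kappa * (w x ^+ k.+1 / x))).
Proof.
move=> x01; have x0 : 0 < x by lra.
have := is_deriveB (T_derive x01)
  (is_deriveZ (k%:R * kappa) (is_derive1_ln x0)).
by move/is_derive_eq; apply; rewrite /GRing.scale /=; ring.
Qed.

Lemma reduced_stress_nonincreasing (a b : R) :
  0 < a -> a <= b -> b < 1 -> S b <= S a.
Proof.
move=> a0 ab b1.
apply: (@derive_le0_ge _ _ (fun x => - (k%:R * kappa * (w x ^+ k.+1 / x))))
  => // [x xab|].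
  have x01 : 0 < x < 1 by lra.
  split; first exact: reduced_stress_derive.
  have x0 : 0 < x by lra.
  by rewrite oppr_le0 !mulr_ge0 ?invr_ge0 ?exprn_ge0 // ltW ?ratio_gt0.
apply: is_derive_within_continuous => x /(itvI01 a0 b1).
exact: reduced_stress_derive.
Qed.

(* [w ^ n <= w] and [w x / x] is the derivative of [ln r] *)
Lemma reduced_stress_ln_nondecreasing (a b : R) : 0 < a -> a <= b -> b < 1 ->
  S a + k%:R * kappa * ln (r a) <= S b + k%:R * kappa * ln (r b).
Proof.
move=> a0 ab b1.
have dS (x : R) : 0 < x < 1 -> is_derive x 1 (fun x => S x + k%:R * kappa * ln (r x))
    (k%:R * kappa * ((w x - w x ^+ k.+1) / x)).
  move=> x01; have x0 : x != 0 by rewrite gt_eqF //; lra.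
  have rx := radius_gt0 x01.
  have := is_deriveD (reduced_stress_derive x01) (is_deriveZ (k%:R * kappa)
    (is_derive1_comp (is_derive1_ln rx) (r_derive x01))).
  move/is_derive_eq; apply; rewrite /GRing.scale /= /w /q /hoop.
  by field; rewrite x0 lt0r_neq0.
apply: (@derive_ge0_le _ (fun x => S x + k%:R * kappa * ln (r x))
  (fun x => k%:R * kappa * ((w x - w x ^+ k.+1) / x)))
  => // [x xab|].
  have x01 : 0 < x < 1 by lra.
  split; first exact: dS.
  have x0 : 0 < x by lra.
  rewrite !mulr_ge0 ?invr_ge0 // ?(ltW x0) // ?(ltW kappa_gt0) // subr_ge0.
  by rewrite exprS ler_piMr ?exprn_ile1 ?ratio_le1 // ltW ?ratio_gt0.
by apply: is_derive_within_continuous => x /(itvI01 a0 b1); exact: dS.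
Qed.

(** [S] grows monotonically as [x] decreases to 0, so an upper bound suffices. It comes from
    comparing [S + k kappa ln r] at [x] and at a fixed [b], with [ln r] bounded below by [ln r0]. *)
Lemma reduced_stress_cvg : exists l : R, S x @[x --> 0^'+] --> l.
Proof.
pose b : R := 2^-1; have b0 : 0 < b by rewrite invr_gt0.
have b1 : b < 1 by rewrite invf_lt1 // ltr1n.
have Sni : {in `]0, b[%R &, {homo S : x y /~ y <= x}}.
  move=> x y; rewrite !in_itv /= => /andP[x0 xb] /andP[y0 yb] xy.
  by apply: reduced_stress_nonincreasing => //; lra.
have Sub : has_ubound [set S x | x in `]0, b[].
  case: r_inf_gt0 => r0 r00 rr0.
  exists (S b + k%:R * kappa * ln (r b) - k%:R * kappa * ln r0) => _ [x /= + <-].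
  rewrite in_itv /= => /andP[x0 xb].
  have := reduced_stress_ln_nondecreasing x0 (ltW xb) b1.
  have : k%:R * kappa * ln r0 <= k%:R * kappa * ln (r x).
    have r0x : r0 <= r x by apply: rr0; lra.
    rewrite ler_wpM2l ?mulr_ge0 // ?(ltW kappa_gt0) // ler_ln ?posrE //.
    exact: lt_le_trans r0x.
  by lra.
have b0' : (BRight 0 < BLeft b :> itv_bound R)%O by rewrite bnd_simp.
by eexists; exact: (nonincreasing_at_right_cvgr b0' Sni Sub).
Qed.

End StrainRatio.

(** * From the radius to the circumferential strain *)

(** Serves both divergence claims: [L] is [ln] at 0 for the radius, and [- ln] at infinity for the
    strain. *)
Lemma cvgNy_affine (R : realType) (F : set_system R) {FF : Filter F}
    (f L : R -> R) (c l : R) : 0 < c ->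
  f x - c * L x @[x --> F] --> l -> L x @[x --> F] --> -oo ->
  f x @[x --> F] --> -oo.
Proof.
move=> c0 fl LNy; apply/cvgrNyPle => A.
have l1 : l < l + 1 by rewrite ltrDl.
near=> x.
have fx : f x - c * L x <= l + 1 by near: x; exact: cvgr_le fl _ l1.
have : L x <= (A - l - 1) / c by near: x; exact: cvgrNy_le.
rewrite ler_pdivlMr // mulrC; lra.
Unshelve. all: by end_near. Qed.

Lemma lnNyV (R : realType) : - ln (v : R) @[v --> +oo] --> -oo.
Proof.
apply/cvgrNyPle => A; near=> v.
have v0 : 0 < v by near: v; exact: nbhs_pinfty_gt.
have Av : expR (- A) <= v by near: v; exact: nbhs_pinfty_ge.
by rewrite lerNl -[- A]expRK ler_ln ?posrE ?expR_gt0.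
Unshelve. all: by end_near. Qed.

Lemma hoop_within_continuous (R : realType) (r : R -> R) (a b : R) :
  0 < a -> b <= 1 -> {within `[0, 1], continuous r} ->
  {within `[a, b], continuous (hoop r)}.
Proof.
move=> a0 b1 rc.
have rab : {within `[a, b], continuous r}.
  by apply: continuous_subspaceW rc; move=> y; rewrite /= !in_itv /=; lra.
have iab : {within `[a, b], continuous (@GRing.inv R)}.
  apply: continuous_subspace_itv => x; rewrite in_itv /= => /andP[ax _].
  by apply: inv_continuous; rewrite gt_eqF // (lt_le_trans a0).
by move=> x; apply: cvgM; [exact: rab|exact: iab].
Qed.

(* [x] may be an end point; one-sided difference quotients suffice there. *)
Lemma rderiv_hoop_cst (R : realType) (r : R -> R) (a b l x : R) :
  0 < a -> a < b -> b <= 1 -> (forall y, a <= y <= b -> hoop r y = l) ->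
  a <= x <= b -> derivable_in `]0, 1] r x -> rderiv r x = l.
Proof.
move=> a0 ab b1 rl xab dr.
have rE y : a <= y <= b -> r y = l * y.
  by move=> yab; rewrite -(rl _ yab) /hoop divfK // gt_eqF //; lra.
(* On the interval [r] is linear with slope [l], so every difference quotient equals [l]. Any proper
   filter of points of the interval other than [x] therefore identifies the limit. *)
have key (F : set_system R) (FF : ProperFilter F) : F `=>` x^' ->
    (\forall y \near F, a <= y <= b) -> rderiv r x = l.
  move=> Fx Fab.
  have FA : F `=>` within `]0, 1] x^'.
    move=> U /Fx; apply: filterS2 Fab => y yab; apply; rewrite /= in_itv /=; lra.
  apply: (cvg_unique (@Rhausdorff R) (derive_in_cvg FA dr)).
  apply: cvg_near_cst; have := Fx _ (nbhs_dnbhs_neq x).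
  apply: filterS2 Fab => y yab yx; rewrite !rE // -mulrBr mulfK // subr_eq0.
  exact: yx.
have [xb|bx] := ltP x b.
  apply: (key x^'+ (at_right_proper_filter x)).
    by move=> U; rewrite /dnbhs /at_right /within /=; apply: filterS => y yU xy;
      apply: yU; rewrite gt_eqF.
  near=> y; apply/andP; split; last by near: y; exact: nbhs_right_le.
  by apply: (@le_trans _ _ x); [case/andP: xab|near: y; exact: nbhs_right_ge].
apply: (key x^'- (at_left_proper_filter x)).
  by move=> U; rewrite /dnbhs /at_left /within /=; apply: filterS => y yU xy;
    apply: yU; rewrite lt_eqF.
near=> y; apply/andP; split.
  by near: y; apply: nbhs_left_ge; exact: lt_le_trans bx.
by apply: (@le_trans _ _ x); [near: y; exact: nbhs_left_le|case/andP: xab].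
Unshelve. all: by end_near. Qed.

Lemma stress_of_strain (R : realType) (r T : R -> R) (c l : R) : 0 < c ->
  {within `[0, 1], continuous r} -> 0 < r 0 ->
  (forall a b : R, 0 < a -> a <= b -> b <= 1 -> hoop r b <= hoop r a) ->
  (forall a b : R, 0 < a -> a <= b -> b <= 1 -> hoop r a = hoop r b -> T a = T b) ->
  T x - c * ln x @[x --> 0^'+] --> l ->
  exists Tv : R -> R, [/\ function_of_strain r T Tv,
    exists l' : R, Tv v + c * ln v @[v --> +oo] --> l' & Tv v @[v --> +oo] --> -oo].
Proof.
move=> c0 rc r0 qni Tq Sl.
pose pre v x := 0 < x <= 1 /\ hoop r x = v.
(* The default 1 is used only at strains that are not attained; by [attained] these are not
   arbitrarily large. *)
pose Tv v := T (xget 1 (pre v)).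
have r0cvg : r x @[x --> 0^'+] --> r 0.
  by case/(continuous_within_itvP _ (@ltr01 R)) : rc.
have TvE x : 0 < x <= 1 -> Tv (hoop r x) = T x.
  move=> x01; rewrite /Tv; case: xgetP => [y _ [/andP[y0 y1] yx]|/(_ x)]; last first.
    by case; split.
  have /andP[x0 x1] := x01.
  by case/orP: (le_total x y) => xy; [apply/esym|]; apply: Tq.
have attained : \forall v \near +oo, exists2 x : R, 0 < x <= 1 & hoop r x = v.
  near=> v.
  have v0 : 0 < v by near: v; exact: nbhs_pinfty_gt.
  have v1 : hoop r 1 <= v.
    by near: v; apply: nbhs_pinfty_ge; exact: num_real.
  (* Close to 0 one has r(x) >= r(0)/2, so x <= r(0)/(2v) gives a strain of at least [v]. The strain
     at 1 is at most [v], and the intermediate value theorem applies on [x, 1]. *)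
  have [x [x0 x1 xv rx]] : exists x,
      [/\ 0 < x, x <= 1, x <= r 0 / 2 / v & r 0 / 2 <= r x].
    apply: (@filter_ex _ 0^'+); near=> x; split; near: x.
    - exact: nbhs_right_gt.
    - exact: nbhs_right_le.
    - by apply: nbhs_right_le; rewrite !divr_gt0.
    - by apply: (cvgr_ge _ r0cvg); rewrite ltr_pdivrMr // ltr_pMr // ltr1n.
  have vx : v <= hoop r x.
    by rewrite ler_pdivlMr // mulrC -ler_pdivlMr // (le_trans xv) // ler_pM2r ?invr_gt0.
  have [|y] := IVT x1 (hoop_within_continuous x0 (lexx (1 : R)) rc) (v := v).
    by rewrite ge_min le_max v1 vx orbT.
  rewrite in_itv /= => /andP[xy y1] yv; exists y => //.
  by rewrite y1 (lt_le_trans x0).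
have fs : function_of_strain r T Tv by [].
have Tvl : Tv v + c * ln v @[v --> +oo] --> l + c * ln (r 0).
  have Srl : T x - c * ln x + c * ln (r x) @[x --> 0^'+] --> l + c * ln (r 0).
    apply: cvgD => //; apply: cvgMr.
    by apply: (continuous_cvg _ (continuous_ln r0) r0cvg).
  apply/cvgrPdist_le => e e0.
  have /cvgrPdist_le/(_ e e0) := Srl.
  case=> d /= d0 dS; near=> v.
  have [x x01 xv] : exists2 x : R, 0 < x <= 1 & hoop r x = v by near: v.
  have v0 : 0 < v by near: v; exact: nbhs_pinfty_gt.
  have [x0 x1] := andP x01.
  (* As the strain is nonincreasing, a value above [hoop r d] occurs only at points below [d]. Large
     [v] thus forces small [x], and the limit at 0 can be used. *)
  have xd : x < d.
    rewrite ltNge; apply/negP => dx.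
    have : hoop r d < v.
      by near: v; apply: nbhs_pinfty_gt; exact: num_real.
    by apply/negP; rewrite -leNgt -xv qni.
  (* Hence ln r(x) = ln v + ln x, and the terms in ln x cancel. *)
  have rx : r x = v * x by rewrite -xv /hoop divfK ?gt_eqF.
  have := dS x _ x0; rewrite /ball /= sub0r normrN gtr0_norm // => /(_ xd).
  rewrite -[in Tv v]xv TvE // rx lnM ?posrE //; congr (`| _ | <= _); ring.
exists Tv; split=> //; first by exists (l + c * ln (r 0)).
apply: (@cvgNy_affine _ _ _ _ (fun v => - ln v) c (l + c * ln (r 0)) c0 _
  (@lnNyV R)).
by under eq_fun do rewrite mulrN opprK.
Unshelve. all: by end_near. Qed.

(** * Radial solutions of the equilibrium equation *)

Section RadialSolution.
Variables (R : realType) (m : nat) (kappa : R) (h r : R -> R).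
(** With n written as [m.+2], the exponents n - 1 and n - 2 compute to [m.+1] and [m]. *)
Let Phi := @stored_energy R m.+2 kappa h.
Let g := derive1 h.
Let p := rderiv r.
Let q := hoop r.
Let T := radial_stress Phi r.
Hypothesis kappa_gt0 : 0 < kappa.
Hypothesis h_admissible : admissible_h h.
Hypothesis r_solution : radial_solution Phi r.
Hypothesis r0_gt0 : 0 < r 0.

Lemma dh_increasing (x y : R) : 0 < x -> x < y -> g x < g y.
Proof.
move=> x0 xy; case: h_admissible => _ _ dh _ _.
apply: (@gtr0_derive1_lt_cc _ g x y) => //.
- by move=> z; rewrite in_itv /= => xzy; apply: (dh z _).1; lra.
- by move=> z; rewrite in_itv /= => xzy; apply: (dh z _).2; lra.
- apply: derivable_within_continuous => z; rewrite in_itv /= => xzy.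
  by apply: (dh z _).1; lra.
- by rewrite in_itv /= lexx ltW.
- by rewrite in_itv /= lexx ltW.
Qed.

Lemma interior01 (x : R) : 0 < x < 1 -> (`]0, 1]%classic : set R)° x.
Proof.
move=> x01; have /near_in_itvoo : x \in `]0, 1[%R by rewrite in_itv.
by rewrite /interior; apply: filterS => y; rewrite /= !in_itv /=; lra.
Qed.

Lemma radius_derive (x : R) : 0 < x < 1 -> is_derive x 1 r (p x).
Proof.
move=> x01; case: r_solution => -[dr _ _] _ _ _.
by apply: is_derive_in (interior01 x01) _; apply: dr; rewrite /= in_itv /=; lra.
Qed.

Lemma rderiv_continuous (x : R) : 0 < x < 1 -> {for x, continuous p}.
Proof.
move=> x01; case: r_solution => -[_ ddr _] _ _ _.
apply: is_derive_continuous (is_derive_in (interior01 x01) _).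
by apply: ddr; rewrite /= in_itv /=; lra.
Qed.

Lemma strains_gt0 (x : R) : 0 < x <= 1 -> 0 < p x /\ 0 < q x.
Proof. by case: r_solution => _ _ + _; apply. Qed.

Lemma h_derivable (d : R) : 0 < d -> derivable h d 1.
Proof. by case: h_admissible => _ [+ _] _ _ _; apply. Qed.

Lemma radial_partial (x : R) : 0 < x <= 1 ->
  partial Phi 0 (principal_stretches m.+2 r x) =
  kappa * p x ^+ m.+1 + g (p x * q x ^+ m.+1) * q x ^+ m.+1.
Proof.
move=> /strains_gt0[p0 q0].
have := @partial_stored_energy R m.+2 kappa h ord0 (principal_stretches m.+2 r x).
rewrite !prod_principal_stretches mxE /= -/p -/q => ->; last 2 first.
- exact: lt0r_neq0.
- by apply: h_derivable; rewrite mulr_gt0 // exprn_gt0.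
by rewrite mulrAC mulfV ?mul1r ?lt0r_neq0.
Qed.

Lemma hoop_partial (x : R) : 0 < x <= 1 ->
  partial Phi 1 (principal_stretches m.+2 r x) =
  kappa * q x ^+ m.+1 + g (p x * q x ^+ m.+1) * (p x * q x ^+ m).
Proof.
move=> /strains_gt0[p0 q0].
have := @partial_stored_energy R m.+2 kappa h (lift ord0 ord0)
  (principal_stretches m.+2 r x).
rewrite !prod_principal_stretches mxE /= -/p -/q => ->; last 2 first.
- exact: lt0r_neq0.
- by apply: h_derivable; rewrite mulr_gt0 // exprn_gt0.
suff -> : p x * q x ^+ m.+1 / q x = p x * q x ^+ m by [].
by rewrite exprSr mulrA mulfK ?lt0r_neq0.
Qed.

(** The prefactor of [T] is q^(-(n-1)), which cancels the q^(n-1) multiplying h'. The argument of h'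
    is p q^(n-1) = w q^n for w = p/q. *)
Lemma radial_stress_strains (x : R) : 0 < x <= 1 ->
  T x = kappa * (p x / q x) ^+ m.+1 + g (p x / q x * q x ^+ m.+2).
Proof.
move=> x01; have [p0 q0] := strains_gt0 x01; rewrite /T /radial_stress radial_partial //.
have -> : x / r x = (q x)^-1 by rewrite /q /hoop invf_div.
have -> : p x / q x * q x ^+ m.+2 = p x * q x ^+ m.+1.
  by rewrite (exprS _ m.+1) mulrA divfK ?lt0r_neq0.
rewrite mulrDr mulrCA -exprMn [_^-1 * _]mulrC; congr (_ + _).
by rewrite mulrCA -exprMn mulVf ?lt0r_neq0 // expr1n mulr1.
Qed.

(** [T] is the product of R^(n-1) Phi_1, whose derivative the equilibrium equation supplies, and
    r^(-(n-1)). The two factors contribute (n-1) h' p / r with opposite signs. *)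
Lemma radial_stress_derive (x : R) : 0 < x < 1 ->
  is_derive x 1 T (m.+1%:R * kappa * x^-1 * (1 - (p x / q x) ^+ m.+2)).
Proof.
move=> x01; have x01' : 0 < x <= 1 by lra.
have [p0 q0] := strains_gt0 x01'.
have x0 : 0 < x by lra.
have rx : 0 < r x by have := mulr_gt0 q0 x0; rewrite /q /hoop divfK // lt0r_neq0.
case: r_solution => _ _ _ /(_ x x01) /= dG.
have -> : T = (fun s => s ^+ m.+1 * partial Phi 0 (principal_stretches m.+2 r s)) *
    (fun s => (r s)^-1) ^+ m.+1.
  apply/funext => s; rewrite /T /radial_stress fctE /= mulrAC; congr (_ * _).
  by rewrite exprMn fctE.
have := is_deriveM dG (is_deriveX m.+1 (is_deriveV (lt0r_neq0 rx) (radius_derive x01))).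
move/is_derive_eq; apply.
rewrite radial_partial // hoop_partial // fctE /GRing.scale /=.
(* The value of h' cancels, so it is abstracted before the field computation. *)
move: (g _) => gx; rewrite /q /hoop !exprS !expr_div_n.
have xm : x ^+ m != 0 by rewrite expf_neq0 // lt0r_neq0.
have rm : r x ^+ m != 0 by rewrite expf_neq0 // lt0r_neq0.
have x0' := lt0r_neq0 x0; have rx' := lt0r_neq0 rx.
rewrite exprVn; field.
by rewrite xm rm x0' rx'.
Qed.

(** [r] increases and is continuous down to the origin, so the cavity radius [r 0] is the positive
    lower bound required by the estimates on the strain ratio. *)
Lemma radius_ge (x : R) : 0 < x < 1 -> r 0 <= r x.
Proof.
move=> x01; case: r_solution => _ rc _ _.
apply: (@derive_ge0_le _ _ p) => [|y yx|]; first by lra.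
  split; first by apply: radius_derive; lra.
  by rewrite ltW //; apply: (strains_gt0 _).1; lra.
by apply: continuous_subspaceW rc => y; rewrite /= !in_itv /=; lra.
Qed.

Let radius_inf : exists2 r0 : R, 0 < r0 & forall x : R, 0 < x < 1 -> r0 <= r x.
Proof. by exists (r 0) => //; exact: radius_ge. Qed.

Let p_gt0 (x : R) : 0 < x < 1 -> 0 < p x.
Proof. by move=> x01; apply: (strains_gt0 _).1; lra. Qed.

Let T_strains (x : R) : 0 < x < 1 ->
  T x = kappa * (p x / q x) ^+ m.+1 + g (p x / q x * q x ^+ m.+2).
Proof. by move=> x01; apply: radial_stress_strains; lra. Qed.

(** Since [w <= 1] inside (0,1), the derivative (w - 1) q / x is nonpositive there; continuity
    extends the comparison to the end point 1. *)
Lemma hoop_nonincreasing (a b : R) : 0 < a -> a <= b -> b <= 1 -> q b <= q a.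
Proof.
move=> a0 ab b1; case: r_solution => _ rc _ _.
apply: (@derive_le0_ge _ _ (fun x => (p x / q x - 1) * (q x / x))) => // [x xab|].
  have x01 : 0 < x < 1 by lra.
  have x0 : 0 < x by lra.
  split; first exact: (hoop_derive radius_inf radius_derive).
  have w1 := ratio_le1 kappa_gt0 radius_inf radius_derive p_gt0 rderiv_continuous
    dh_increasing T_strains radial_stress_derive x01.
  rewrite mulr_le0_ge0 ?subr_le0 // ltW // divr_gt0 //.
  by apply: (strains_gt0 _).2; lra.
exact: hoop_within_continuous.
Qed.

(** Equal strains at [a] and [b] force the monotone [q] to be constant between them. There [r] is
    linear with slope [q], so p = q at both ends, and [T] depends only on [p] and [q]. *)
Lemma radial_stress_of_hoop (a b : R) : 0 < a -> a <= b -> b <= 1 ->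
  q a = q b -> T a = T b.
Proof.
move=> a0; rewrite le_eqVlt => /predU1P[-> //|ab] b1 qab.
have qcst y : a <= y <= b -> q y = q a.
  move=> /andP[ay yb]; apply/le_anti/andP; split.
    by apply: hoop_nonincreasing => //; lra.
  by rewrite qab; apply: hoop_nonincreasing => //; lra.
have pcst y : a <= y <= b -> p y = q a.
  move=> yab; apply: (rderiv_hoop_cst a0 ab b1 qcst yab).
  by case: r_solution => -[dr _ _] _ _ _; apply: dr; rewrite /= in_itv /=; lra.
have pa : p a = q a by apply: pcst; lra.
have pb : p b = q a by apply: pcst; lra.
by rewrite !radial_stress_strains ?pa ?pb ?qab //; lra.
Qed.

Lemma radial_stress_limits :
  [/\ exists l : R, T x - m.+1%:R * kappa * ln x @[x --> 0^'+] --> l,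
      T x @[x --> 0^'+] --> -oo
    & exists Tv : R -> R,
        [/\ function_of_strain r T Tv,
            exists l : R, Tv v + m.+1%:R * kappa * ln v @[v --> +oo] --> l
          & Tv v @[v --> +oo] --> -oo]].
Proof.
have c0 : 0 < m.+1%:R * kappa by rewrite mulr_gt0 ?ltr0n.
have [l Sl] := reduced_stress_cvg kappa_gt0 radius_inf radius_derive p_gt0
  rderiv_continuous dh_increasing T_strains radial_stress_derive.
case: r_solution => _ rc _ _.
split; first by exists l.
  exact: cvgNy_affine c0 Sl (@lnNy R).
apply: stress_of_strain c0 rc r0_gt0 _ _ Sl.
  exact: hoop_nonincreasing.
exact: radial_stress_of_hoop.
Qed.

End RadialSolution.

Theorem proposition2p2 (R : realType) (n : nat) (kappa : R) (h r : R -> R)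
    (hn : n = 2%N \/ n = 3%N) (hkappa : 0 < kappa) (hh : admissible_h h)
    (hr : radial_solution (@stored_energy R n kappa h) r) (hr0 : 0 < r 0) :
  let T := radial_stress (@stored_energy R n kappa h) r in
  [/\ exists l : R, T x - n.-1%:R * kappa * ln x @[x --> 0^'+] --> l,
      T x @[x --> 0^'+] --> -oo
    & exists Tv : R -> R,
        [/\ function_of_strain r T Tv,
            exists l : R, Tv v + kappa * n.-1%:R * ln v @[v --> +oo] --> l
          & Tv v @[v --> +oo] --> -oo]].
Proof.
(* The section above is stated for n = [m.+2]. *)
have [m nE] : exists m, n = m.+2 by case: hn => ->; [exists 0%N | exists 1%N].
move: hr; rewrite nE [kappa * _]mulrC => hr.
exact: radial_stress_limits hkappa hh hr hr0.
Qed.
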